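(* Let $n\ge 2$ and $r$ be integers. If $r > \binom{\lceil 2\sqrt{n}\rceil}{2}(n-1)+\lceil 2\sqrt{n}\rceil$, then ${\rm sg}(P_r\,\square\, P_n)= \lceil 2\sqrt{n}\, \rceil$.
   Context: $P_m$ denotes the path with vertex set $\{1,\dots,m\}$ and edges $\{i,i+1\}$. The Cartesian product $G\,\square\, H$ has vertex set $V(G)\times V(H)$, with $(g,h)$ adjacent to $(g',h')$ iff either $g=g'$ and $hh'\in E(H)$, or $h=h'$ and $gg'\in E(G)$. For a graph $G=(V,E)$ and $S\subseteq V$, for each pair $\{x,y\}\subseteq S$ with $x\neq y$ let $\widetilde{P}(x,y)$ be a selected fixed shortest $x,y$-path, and let $\widetilde{I}(S)=\{\widetilde{P}(x,y): x,y\in S\}$. $S$ is a strong geodetic set if for some such choice of geodesics, every vertex of $G$ lies on some path of $\widetilde{I}(S)$. The strong geodetic number ${\rm sg}(G)$ is the minimum cardinality of a strong geodetic set of $G$. *)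

(* Defs.v *)
From mathcomp Require Import all_boot all_order all_algebra.
From mathcomp Require Import boolp reals.
Set Implicit Arguments.
Unset Strict Implicit.
Unset Printing Implicit Defensive.

Record sgraph := SGraph {
  vertex :> finType;
  adj : rel vertex;
  adj_sym : symmetric adj;
  adj_irrefl : irreflexive adj }.

Arguments adj {_}.

(* The paper's vertices 1, ..., m are represented by 0, ..., m - 1. *)
Definition path_adj (m : nat) : rel 'I_m :=
  fun i j => (i.+1 == j) || (j.+1 == i).

Lemma path_adj_sym m : symmetric (@path_adj m).
Proof. by move=> i j; rewrite /path_adj orbC. Qed.

Lemma path_adj_irrefl m : irreflexive (@path_adj m).
Proof. by move=> i; rewrite /path_adj gtn_eqF. Qed.

Definition path_graph (m : nat) : sgraph :=
  SGraph (@path_adj_sym m) (@path_adj_irrefl m).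

Section CartesianProduct.
Variables G H : sgraph.

Definition cart_adj : rel (G * H) := fun u v =>
  ((u.1 == v.1) && adj u.2 v.2) || ((u.2 == v.2) && adj u.1 v.1).

Lemma cart_adj_sym : symmetric cart_adj.
Proof.
move=> u v; rewrite /cart_adj (eq_sym u.1) (eq_sym u.2).
by rewrite (@adj_sym H u.2) (@adj_sym G u.1).
Qed.

Lemma cart_adj_irrefl : irreflexive cart_adj.
Proof. by move=> u; rewrite /cart_adj !adj_irrefl !andbF. Qed.

Definition cart_prod : sgraph := SGraph cart_adj_sym cart_adj_irrefl.
End CartesianProduct.

Section StrongGeodetic.
Variable G : sgraph.

(* A walk is given by the sequence of all its vertices, endpoints included. *)
Definition is_walk (x y : G) (s : seq G) : Prop :=
  exists p : seq G, [/\ s = x :: p, path adj x p & last x p = y].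

(* A walk of minimum length never repeats a vertex, so this is a shortest
   path. *)
Definition is_geodesic (x y : G) (s : seq G) : Prop :=
  is_walk x y s /\ forall t : seq G, is_walk x y t -> size s <= size t.

(* P selects one geodesic per unordered pair: P y x is P x y read backwards. *)
Definition geodesic_choice (S : {set G}) (P : G -> G -> seq G) : Prop :=
  forall x y : G, x \in S -> y \in S -> x != y ->
    is_geodesic x y (P x y) /\ P y x = rev (P x y).

Definition strong_geodetic (S : {set G}) : Prop :=
  exists2 P : G -> G -> seq G, geodesic_choice S P &
    forall v : G, exists x y : G, [/\ x \in S, y \in S, x != y & v \in P x y].

(* By the two lemmas below this is the minimum whenever some strong geodetic
   set exists; otherwise it is #|G|. *)
Definition strong_geodetic_number : nat :=
  \big[minn/#|G|]_(S : {set G} | `[< strong_geodetic S >]) #|S|.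

Lemma strong_geodetic_number_le (S : {set G}) :
  strong_geodetic S -> strong_geodetic_number <= #|S|.
Proof.
move=> /asboolP sgS; rewrite /strong_geodetic_number.
have : S \in index_enum {set G} by exact: mem_index_enum.
elim: (index_enum _) => //= T s IHs; rewrite in_cons big_cons.
case/predU1P => [<-|/IHs leS]; first by rewrite sgS geq_minl.
by case: ifP => // _; apply: leq_trans leS; exact: geq_minr.
Qed.

Lemma strong_geodetic_number_attained (S0 : {set G}) :
  strong_geodetic S0 ->
  exists2 S : {set G}, strong_geodetic S & #|S| = strong_geodetic_number.
Proof.
move=> sgS0; have := strong_geodetic_number_le sgS0.
rewrite /strong_geodetic_number.
elim/big_ind: _ => [leG|a b IHa IHb|S /asboolP sgS _].
- by exists S0 => //; apply/eqP; rewrite eqn_leq leG max_card.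
- by rewrite /minn; case: ifP.
- by exists S.
Qed.
End StrongGeodetic.

Definition ceil_2sqrt (R : realType) (n : nat) : nat :=
  `|Num.ceil (2 * Num.sqrt (n%:R : R))%R|%N.

(* Main.v *)
(** Given k chosen vertices with C(k,2)(n-1) + k < r, the vertical edges of their
    geodesics meet at most C(k,2)(n-1) columns, so some column meets no vertical
    edge and no chosen vertex.  Each geodesic meets that column at most once, and
    only if its ends lie on different sides, so n is at most the product of the
    numbers of chosen vertices on the two sides, hence at most k^2/4.

    Conversely let k = ceil(2 sqrt n), a = floor(k/2), b = ceil(k/2), so
    n <= ab.  Take the a topmost vertices of the first column and the b
    bottommost of the last one; the geodesic from row i to row n-b+j crosses the
    grid along row min(ib+j, n-b+j), and these ab rows exhaust 0, ..., n-1. *)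

Require Import Defs.
From mathcomp Require Import all_boot all_order all_algebra.
From mathcomp Require Import boolp reals zify.

Set Implicit Arguments.
Unset Strict Implicit.
Unset Printing Implicit Defensive.

Lemma card_bigcup_le (I T : finType) (Q : pred I) (A : I -> {set T}) :
  #|\bigcup_(i | Q i) A i| <= \sum_(i | Q i) #|A i|.
Proof.
elim/big_rec2: _ => [|i m B _ leB]; first by rewrite cards0.
by apply: leq_trans (leq_card_setU _ _) _; rewrite leq_add2l.
Qed.

(** * Reversing, splitting and concatenating walks *)

Section Walks.
Variable G : sgraph.
Implicit Types (x y z : G) (s : seq G).

Lemma is_walk_rev x y s : is_walk x y s -> is_walk y x (rev s).
Proof.
case=> p [-> xp <-]; exists (rev (belast x p)); split.
- by rewrite lastI rev_rcons.
- by rewrite rev_path (eq_path (e' := adj)) // => u v; rewrite /= adj_sym.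
- by case: p {xp} => //= z p; rewrite rev_cons last_rcons.
Qed.

Lemma is_geodesic_rev x y s : is_geodesic x y s -> is_geodesic y x (rev s).
Proof.
case=> /is_walk_rev ys le_s; split=> // t /is_walk_rev /le_s.
by rewrite !size_rev.
Qed.

Lemma is_walk_split x y z s : is_walk x y s -> z \in s ->
  exists s1 s2, [/\ is_walk x z s1, is_walk z y s2
                  & size s1 + size s2 = (size s).+1].
Proof.
case=> p [-> + <-] zp; case/splitPl: zp => p1 p2 lz.
rewrite cat_path last_cat lz => /andP[xp1 zp2].
exists (x :: p1), (z :: p2); split; first by exists p1.
  by exists p2.
by rewrite /= size_cat addnS.
Qed.

Lemma is_walk_cat x y z s1 s2 : is_walk x y s1 -> is_walk y z s2 ->
  exists s, [/\ is_walk x z s, (size s).+1 = size s1 + size s2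
              & forall t, t \in s = (t \in s1) || (t \in s2)].
Proof.
case=> p1 [-> xp1 <-] [p2 [-> yp2 <-]]; exists (x :: p1 ++ p2); split.
- by exists (p1 ++ p2); rewrite cat_path xp1 yp2 last_cat.
- by rewrite /= size_cat addnS.
- move=> t; rewrite -cat_cons !mem_cat [t \in _ :: p2]inE.
  by case: eqP => [->|_] //=; rewrite mem_last.
Qed.
End Walks.

(** * Distance and geodesics in the grid *)

Definition absdiff (i j : nat) : nat := (i - j) + (j - i).

Arguments adj : simpl never.

Section Grid.
Variables r n : nat.
Notation grid := (cart_prod (path_graph r) (path_graph n)).
Implicit Types (x y z t u w : grid) (s : seq grid).

Definition gdist u w : nat := absdiff u.1 w.1 + absdiff u.2 w.2.

Lemma grid_adjE u w : adj u w = (gdist u w == 1).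
Proof.
case: u w => [u1 u2] [w1 w2].
rewrite /adj /= /cart_adj /gdist /adj /= /path_adj /absdiff -!val_eqE /=.
by apply/idP/idP; lia.
Qed.

Lemma walk_gdist x y s : is_walk x y s -> gdist x y < size s.
Proof.
case=> p [-> + <-]; elim: p x => [|z p IHp] x /=; first by rewrite /gdist /absdiff; lia.
rewrite grid_adjE => /andP[/eqP xz /IHp] /=.
by move: xz; rewrite /gdist /absdiff; lia.
Qed.

Lemma ord_step m (i j : 'I_m) : i != j ->
  exists i' : 'I_m, absdiff i i' = 1 /\ absdiff i' j + 1 = absdiff i j.
Proof.
rewrite -val_eqE /= /absdiff => ij; have [lt_ij|le_ji] := ltnP i j.
  by exists (Ordinal (leq_ltn_trans lt_ij (ltn_ord j))) => /=; lia.
have lt_i : i.-1 < m by have := ltn_ord i; lia.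
by exists (Ordinal lt_i) => /=; lia.
Qed.

(** Induction on the distance, stepping towards [w] along the common line. The coverage clause later
    lets one path cover a whole row. *)
Lemma line_walk u w : (u.1 = w.1) \/ (u.2 = w.2) ->
  exists2 s, is_walk u w s & size s = (gdist u w).+1 /\
    (forall t, gdist u t + gdist t w = gdist u w -> t \in s).
Proof.
move: {2}(gdist u w) (erefl (gdist u w)) => m; elim: m u => [|m IHm] u dm uw.
  have -> : u = w.
    case: u w dm {uw} => [u1 u2] [w1 w2]; rewrite /gdist /absdiff /= => d0.
    by congr pair; apply: val_inj => /=; lia.
  exists [:: w]; first by exists [::].
  split; first by rewrite /gdist /absdiff /=; lia.
  case: w {dm uw} => [w1 w2] [t1 t2]; rewrite /gdist /absdiff /= inE => d0.
  by apply/eqP; congr pair; apply: val_inj => /=; lia.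
have [u' [uu' u'w uw' int]] : exists u' : grid, [/\ gdist u u' = 1,
    gdist u' w = m, (u'.1 = w.1) \/ (u'.2 = w.2) &
    forall t, gdist u t + gdist t w = gdist u w -> t != u ->
      gdist u' t + gdist t w = gdist u' w].
  case: u w dm uw {IHm} => [u1 u2] [w1 w2] /= dm [] e; subst.
    have [|u' [d1 d2]] := @ord_step n u2 w2.
      by apply/eqP => e; move: dm; rewrite e /gdist /absdiff /=; lia.
    exists (w1, u'); rewrite /gdist /=; split; [| |by left|].
    - by move: d1; rewrite /absdiff; lia.
    - by move: dm d2; rewrite /gdist /= /absdiff; lia.
    - case=> t1 t2; rewrite -pair_eqE /pair_eq -!val_eqE /=.
      by move: d1 d2; rewrite /absdiff; lia.
  have [|u' [d1 d2]] := @ord_step r u1 w1.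
    by apply/eqP => e; move: dm; rewrite e /gdist /absdiff /=; lia.
  exists (u', w2); rewrite /gdist /=; split; [| |by right|].
  - by move: d1; rewrite /absdiff; lia.
  - by move: dm d2; rewrite /gdist /= /absdiff; lia.
  - case=> t1 t2; rewrite -pair_eqE /pair_eq -!val_eqE /=.
    by move: d1 d2; rewrite /absdiff; lia.
have [_ [p [-> u'p lw]] [sz cov]] := IHm u' u'w uw'.
exists (u :: u' :: p).
  by exists (u' :: p); split=> //=; rewrite grid_adjE uu' u'p.
split; first by move: sz => /= ->; rewrite u'w dm.
move=> t ut; rewrite inE; case: (altP (t =P u)) => //= tu.
by apply: cov; apply: int.
Qed.

(** Go vertically to row [v], along that row, then vertically to [w]. Since [v] lies between the two
    end rows, no vertical step is wasted. *)
Lemma geodesic_through_row u w (v : 'I_n) :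
  absdiff u.2 v + absdiff v w.2 = absdiff u.2 w.2 ->
  exists2 s, is_geodesic u w s & forall c : 'I_r,
    absdiff u.1 c + absdiff c w.1 = absdiff u.1 w.1 -> (c, v) \in s.
Proof.
case: u w => [u1 u2] [w1 w2] /= vP.
have [|s1 w1' [z1 _]] := @line_walk (u1, u2) (u1, v); first by left.
have [|s2 w2' [z2 c2]] := @line_walk (u1, v) (w1, v); first by right.
have [|s3 w3' [z3 _]] := @line_walk (w1, v) (w1, w2); first by left.
have [s4 [w4 z4 c4]] := is_walk_cat w1' w2'.
have [s [ws zs cs]] := is_walk_cat w4 w3'.
exists s.
  split=> // t /walk_gdist; apply: leq_trans.
  by move: z1 z2 z3 z4 zs vP; rewrite /gdist /absdiff /=; lia.
move=> c d; rewrite cs c4 c2 ?orbT //.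
by move: d; rewrite /gdist /absdiff /=; lia.
Qed.

Lemma geodesic_size x y s : is_geodesic x y s -> size s = (gdist x y).+1.
Proof.
case=> xs le_s; apply/eqP; rewrite eqn_leq (walk_gdist xs) andbT.
have [|s1 w1 [z1 _]] := @line_walk x (x.1, y.2); first by left.
have [|s2 w2 [z2 _]] := @line_walk (x.1, y.2) y; first by right.
have [s3 [/le_s le3 z3 _]] := is_walk_cat w1 w2.
by move: z1 z2 z3 le3; rewrite /gdist /absdiff /=; lia.
Qed.

(** Each piece of the path cut at [z] is at least as long as the distance it spans; the triangle
    inequality forces equality. *)
Lemma mem_geodesic x y z s : is_geodesic x y s -> z \in s ->
  gdist x z + gdist z y = gdist x y.
Proof.
move=> gs zs; have [s1 [s2 [/walk_gdist l1 /walk_gdist l2 e]]] := is_walk_split gs.1 zs.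
have := geodesic_size gs; move: l1 l2 e; rewrite /gdist /absdiff; lia.
Qed.

(** Discrete intermediate value argument: one step changes the column by at most one. *)
Lemma walk_columns x y s (c : 'I_r) : is_walk x y s -> x.1 <= c <= y.1 ->
  exists v : 'I_n, (c, v) \in s.
Proof.
case=> p [-> + <-]; elim: p x => [|z p IHp] x /=.
  move=> _ cP; exists x.2; rewrite inE; apply/eqP.
  by case: x cP => x1 x2 /= cP; congr pair; apply: val_inj => /=; lia.
case/andP=> xz zp /andP[xc cy].
have [e|ne] := eqVneq c x.1.
  by exists x.2; rewrite inE e -surjective_pairing eqxx.
have [|v vP] := IHp z zp; last by exists v; rewrite inE vP orbT.
by rewrite cy; move: xz xc ne; rewrite grid_adjE -val_eqE /gdist /absdiff /=; lia.
Qed.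

(** * Lower bound: a column crossed only horizontally *)

Definition column s (c : 'I_r) : {set 'I_n} := [set v | (c, v) \in s].
(* On a geodesic, the columns in which it has a vertical edge. *)
Definition vertical_columns s : {set 'I_r} := [set c | 1 < #|column s c|].

Lemma vertical_columns_rev s : vertical_columns (rev s) = vertical_columns s.
Proof.
apply/setP => c; rewrite !inE; suff -> : column (rev s) c = column s c by [].
by apply/setP => v; rewrite !inE mem_rev.
Qed.

Lemma sum_column s : \sum_c #|column s c| <= size s.
Proof.
apply: leq_trans (card_size s).
rewrite -sum1_card (eq_bigr (fun c => \sum_(v | (c, v) \in s) 1)); last first.
  by move=> c _; rewrite -sum1_card; apply: eq_bigl => v; rewrite inE.
by rewrite pair_big_dep /= leq_eqVlt; apply/orP; left; apply/eqP/eq_bigl => -[].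
Qed.

(** A geodesic has one vertex more than the sum of its horizontal and vertical distances. Each
    column from end to end takes one vertex and each vertical column a further one, which leaves at
    most the vertical distance for the latter. *)
Lemma card_vertical_columns x y s :
  is_geodesic x y s -> #|vertical_columns s| <= n - 1.
Proof.
wlog le_xy : x y s / x.1 <= y.1 => [ih gs|gs].
  have [/ih|/ltnW le] := leqP x.1 y.1; first exact.
  rewrite -vertical_columns_rev.
  exact: ih le (is_geodesic_rev gs).
have := sum_column s; rewrite (geodesic_size gs).
have : \sum_(c < r) ((x.1 <= c <= y.1) + (c \in vertical_columns s)) <= \sum_c #|column s c|.
  apply: leq_sum => c _; rewrite inE.
  case: ltnP => [|_]; first by case: (_ <= _ <= _) => //=; lia.
  case: (boolP (_ <= _ <= _)) => // /(walk_columns gs.1)[v vs].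
  by rewrite addn0 card_gt0; apply/set0Pn; exists v; rewrite inE.
rewrite big_split /=.
have -> : \sum_(c < r) (c \in vertical_columns s) = #|vertical_columns s|.
  by rewrite -sum1_card [RHS]big_mkcond; apply: eq_bigr => c _; case: (c \in _).
have -> : \sum_(c < r) (x.1 <= c <= y.1) = y.1 - x.1 + 1.
  have := ltn_ord y.1; move: (nat_of_ord y.1) (nat_of_ord x.1) le_xy => b a le_ab lt_b.
  rewrite -(big_mkord xpredT (fun c => nat_of_bool (a <= c <= b))).
  rewrite (big_cat_nat _ (n := a)) //=; last by lia.
  rewrite (big_cat_nat _ (m := a) (n := b.+1)) //=; last by lia.
  rewrite big_nat big1 ?add0n => [|i]; last by lia.
  rewrite [X in _ + X]big_nat [X in _ + X]big1 => [|i]; last by lia.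
  rewrite big_nat (eq_bigr (fun=> 1)) => [|i ->]; last by [].
  by rewrite -big_nat sum_nat_const_nat; lia.
move=> h1 h2; move: (leq_trans h1 h2); rewrite {gs h1 h2} /gdist /absdiff.
case: x y le_xy => [x1 x2] [y1 y2] /= le_xy.
by have := ltn_ord x2; have := ltn_ord y2; lia.
Qed.

Lemma exists_crossing_column (S : {set grid}) (P : grid -> grid -> seq grid) :
  geodesic_choice S P -> 'C(#|S|, 2) * (n - 1) + #|S| < r ->
  exists c : 'I_r, (forall x, x \in S -> x.1 != c) /\
    (forall x y, x \in S -> y \in S -> x != y -> c \notin vertical_columns (P x y)).
Proof.
move=> PS lt_r; pose e (i : 'I_#|S|) : grid := enum_val i.
(* The forbidden columns; indexing by [i < j] counts each unordered pair once. *)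
pose B := [set (x : grid).1 | x in S] :|:
  \bigcup_(j < #|S|) \bigcup_(i < #|S| | i < j) vertical_columns (P (e i) (e j)).
have leB : #|B| <= 'C(#|S|, 2) * (n - 1) + #|S|.
  apply: leq_trans (leq_card_setU _ _) _; rewrite addnC leq_add ?leq_imset_card //.
  apply: leq_trans (card_bigcup_le _ _) _.
  rewrite -bin2_sum big_mkord big_distrl /=; apply: leq_sum => j _.
  apply: leq_trans (card_bigcup_le _ _) _.
  apply: (@leq_trans (\sum_(i < #|S| | i < j) (n - 1))).
    apply: leq_sum => i ij; have eij : e i != e j.
      by apply/eqP => /enum_val_inj eij; rewrite eij ltnn in ij.
    by have [/card_vertical_columns] := PS _ _ (enum_valP i) (enum_valP j) eij.
  by rewrite (big_ord_narrow (ltnW (ltn_ord j))) /= sum_nat_const card_ord.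
have [c cB] : exists c, c \notin B.
  apply/existsP; apply: contraTT lt_r => /existsPn allB; rewrite -leqNgt.
  apply: leq_trans leB; rewrite -[leqLHS]card_ord -cardsT subset_leq_card //.
  by apply/subsetP => c _; have := allB c; rewrite negbK.
exists c; move: cB; rewrite inE negb_or => /andP[cS cP]; split=> [x xS|].
  by apply: contraNneq cS => <-; apply: imset_f.
have key (i j : 'I_#|S|) : i < j -> c \notin vertical_columns (P (e i) (e j)).
  move=> ij; apply: contra cP => ci; apply/bigcupP; exists j => //.
  by apply/bigcupP; exists i.
move=> x y xS yS xy.
rewrite -(enum_rankK_in xS xS) -(enum_rankK_in xS yS).
move: xy (key (enum_rank_in xS x) (enum_rank_in xS y)) (key (enum_rank_in xS y) (enum_rank_in xS x)).
rewrite /e !enum_rankK_in // => xy.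
have [lt k1 _|lt _ k2|eq] := ltngtP (enum_rank_in xS x) (enum_rank_in xS y).
- exact: k1.
(* Reading a path backwards leaves its vertical columns unchanged. *)
- have [_ ->] := PS y x yS xS (introN eqP (fun e => negP xy (introT eqP (esym e)))).
  by rewrite vertical_columns_rev; exact: k2.
- case/eqP: xy; rewrite -(enum_rankK_in xS xS) -(enum_rankK_in xS yS).
  by congr enum_val; apply: val_inj.
Qed.

Lemma strong_geodetic_card (S : {set grid}) :
  strong_geodetic S -> 'C(#|S|, 2) * (n - 1) + #|S| < r -> 4 * n <= #|S| ^ 2.
Proof.
case=> P PS cov /(exists_crossing_column PS)[c [cS cP]].
have cross (v : 'I_n) : exists xy : grid * grid,
    [/\ xy.1 \in S, xy.2 \in S, xy.1.1 < c < xy.2.1 & (c, v) \in P xy.1 xy.2].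
  have [x [y [xS yS xy vP]]] := cov (c, v).
  have [gP rP] := PS x y xS yS xy.
  have := mem_geodesic gP vP; have := cS x xS; have := cS y yS.
  rewrite -!val_eqE /gdist /absdiff /= => yc xc d.
  (* The geodesic meets column [c], which differs from both end columns, so [c] is strictly between
     them. *)
  have [lt_xc|lt_cx] : x.1 < c < y.1 \/ y.1 < c < x.1.
    clear -yc xc d; case: x y yc xc d => [x1 x2] [y1 y2] /= yc xc d.
    by lia.
    by exists (x, y).
  by exists (y, x); split; rewrite //= rP mem_rev.
have [f fP] := choice cross.
(* Each chosen path meets column [c] at most once, so the pair determines the row. *)
have f_inj : injective f.
  move=> v w e; have [x1 y1 lt vP] := fP v; have [_ _ _ wP] := fP w.
  have xy : (f v).1 != (f v).2.
    by apply/eqP => exy; move: lt; rewrite exy; lia.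
  have := cP _ _ x1 y1 xy; rewrite inE -leqNgt => /card_le1_eqP inj.
  by apply: inj; rewrite inE // e.
pose A := [set x : grid in S | x.1 < c]; pose B := [set x : grid in S | c < x.1].
have leAB : n <= #|A| * #|B|.
  rewrite -cardsX -[leqLHS]card_ord -(card_codom f_inj) subset_leq_card //.
  apply/subsetP => _ /codomP[v ->]; have [x1 y1 /andP[xc cy] _] := fP v.
  by rewrite !inE x1 y1 xc cy.
have : #|A| + #|B| <= #|S|.
  have <- : #|A :|: B| = #|A| + #|B|.
    apply/eqP; rewrite (leq_card_setU A B).2; apply/pred0P => x; rewrite /= !inE.
    by case: (x \in S) => //=; lia.
  by apply/subset_leq_card/subsetP => x; rewrite !inE => /orP[] /andP[].
move: leAB; move: #|A| #|B| #|S| => a b s le_n le_s.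
have : (a + b) ^ 2 <= s ^ 2 by rewrite leq_exp2r.
(* AM-GM: [4ab <= (a + b)^2]. *)
by have [AG _] := nat_AGM2 a b; lia.
Qed.

(** * Upper bound: the two-sided construction *)

Definition lex_lt u w : bool := (u.1 < w.1) || (u.1 == w.1) && (u.2 < w.2).

Lemma lex_lt_neq u w : u != w -> lex_lt w u = ~~ lex_lt u w.
Proof.
case: u w => [u1 u2] [w1 w2]; rewrite /lex_lt -pair_eqE /pair_eq -!val_eqE /=.
by lia.
Qed.

(** From [a + b <= n.+1], a left row [i < a] satisfies [i <= n - b], so the crossing row lies
    between the end rows; [n <= a * b] makes the crossing rows exhaust the grid. *)
Lemma strong_geodetic_two_sides a b :
  0 < a -> 0 < b -> 1 < r -> a + b <= n.+1 -> n <= a * b ->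
  exists2 S : {set grid}, strong_geodetic S & #|S| <= a + b.
Proof.
move=> a0 b0 r1 le_ab le_n.
have le_an : a <= n by lia.
have le_bn : b <= n by lia.
have r0 : 0 < r by lia.
pose lo := Ordinal r0; pose hi := rev_ord lo.
pose L : {set grid} := [set (lo, widen_ord le_an i) | i : 'I_a].
pose R : {set grid} := [set (hi, rev_ord (widen_ord le_bn i)) | i : 'I_b].
have mem_L (i : 'I_n) : i < a -> ((lo, i) : grid) \in L.
  move=> ia; apply/imsetP; exists (Ordinal ia) => //; congr pair.
  exact: val_inj.
have mem_R (i : 'I_n) : n - b <= i -> ((hi, i) : grid) \in R.
  move=> ib; have lt_i : n - i.+1 < b by have := ltn_ord i; lia.
  apply/imsetP; exists (Ordinal lt_i) => //; congr pair.
  by apply: val_inj => /=; have := ltn_ord i; lia.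
(* With y in row n-b+j, this is the row min(ib+j, n-b+j). *)
pose row x y := Ordinal (leq_ltn_trans
  (geq_minr (x.2 * b + (y.2 - (n - b))) y.2) (ltn_ord y.2)).
(* Stated for all pairs so that choice applies; the row is prescribed only from [L] to [R], and any
   geodesic serves elsewhere. *)
have row_geodesic (xy : grid * grid) : exists s, is_geodesic xy.1 xy.2 s /\
    (xy.1 \in L -> xy.2 \in R -> forall c, (c, row xy.1 xy.2) \in s).
  case: xy => x y /=.
  have [/andP[xL yR]|nLR] := boolP ((x \in L) && (y \in R)).
    have [s gs sP] : exists2 s, is_geodesic x y s & forall c : 'I_r,
        absdiff x.1 c + absdiff c y.1 = absdiff x.1 y.1 -> (c, row x y) \in s.
      apply: geodesic_through_row.
      case/imsetP: xL => i _ ->; case/imsetP: yR => j _ ->.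
      by rewrite /absdiff /=; have := ltn_ord i; have := ltn_ord j; nia.
    (* The ends lie in columns [0] and [r - 1], so the horizontal stretch covers its whole row. *)
    exists s; split=> // _ _ c; apply: sP.
    case/imsetP: xL => i _ ->; case/imsetP: yR => j _ ->.
    by rewrite /absdiff /=; have := ltn_ord c; lia.
  have [|s gs _] := @geodesic_through_row x y y.2.
    by rewrite /absdiff; lia.
  by exists s; split=> // xL yR; rewrite xL yR in nLR.
have [P0 P0P] := choice row_geodesic.
(* The two orders of a pair must give mutually reversed paths, so the lexicographic order fixes the
   direction. *)
pose P x y := if lex_lt x y then P0 (x, y) else rev (P0 (y, x)).
exists (L :|: R); last first.
  apply: leq_trans (leq_card_setU _ _) _.
  by rewrite leq_add // (leq_trans (leq_imset_card _ _)) // card_ord.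
exists P => [x y _ _ xy|].
  rewrite /P (lex_lt_neq xy).
  case: ifP => _ /=; split=> //; first exact: (P0P (x, y)).1.
    by apply: is_geodesic_rev; exact: (P0P (y, x)).1.
  by rewrite revK.
case=> c t.
suff [i [j [ia jb rowE]]] : exists i j : 'I_n,
    [/\ i < a, n - b <= j & row (lo, i) (hi, j) = t].
  exists (lo, i), (hi, j); split.
  - by rewrite inE mem_L.
  - by rewrite inE mem_R ?orbT.
  - by apply/eqP => -[e _]; move: r1 e; rewrite /=; lia.
  (* As [1 < r], the left vertex comes first and [P] is [P0] here. *)
  - rewrite /P /lex_lt /= ifT; last by lia.
    by rewrite -rowE; apply: (P0P (_, _)).2; [exact: mem_L | exact: mem_R].
have lt_t := ltn_ord t.
(* For [t < n - b], dividing [t] by [b] gives [i] and [j], and the minimum is [i * b + j]. *)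
have [lt_tn|le_nt] := ltnP t (n - b).
  have i_a : t %/ b < a by rewrite ltn_divLR //; apply: leq_trans le_n.
  have j_b := ltn_pmod t b0.
  have i_n : t %/ b < n by lia.
  have j_n : n - b + t %% b < n by lia.
  exists (Ordinal i_n), (Ordinal j_n); split=> //=; first by lia.
  by apply: val_inj => /=; have := divn_eq t b; lia.
(* Otherwise take [i = a - 1] and right row [t]: by [n <= a * b] the minimum is [t]. *)
have i_n : a.-1 < n by lia.
exists (Ordinal i_n), t; split=> //=; first by lia.
by apply: val_inj => /=; nia.
Qed.
End Grid.

(** * The ceiling of [2 sqrt n] as the least natural [k] with [4n <= k^2] *)

Section CeilSqrt.
Import Order.TTheory GRing.Theory Num.Theory.
Variables (R : realType) (n : nat).

Lemma ceil_2sqrt_le m : 4 * n <= m ^ 2 -> ceil_2sqrt R n <= m.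
Proof.
move=> le_nm; rewrite /ceil_2sqrt -lez_nat gez0_abs.
  rewrite ceil_le_int -(@ler_sqr R) ?nnegrE ?mulr_ge0 ?sqrtr_ge0 //.
  by rewrite exprMn sqr_sqrtr // -!natrX -natrM ler_nat.
by rewrite -[leLHS](ceil0 R) le_ceil // mulr_ge0 ?sqrtr_ge0.
Qed.

Lemma ceil_2sqrt_sqr : 4 * n <= ceil_2sqrt R n ^ 2.
Proof.
suff : (2 * Num.sqrt (n%:R : R) <= (ceil_2sqrt R n)%:R)%R.
  rewrite -(@ler_sqr R) ?nnegrE ?mulr_ge0 ?sqrtr_ge0 //.
  by rewrite exprMn sqr_sqrtr // -!natrX -natrM ler_nat.
rewrite /ceil_2sqrt natr_absz ger0_norm ?ceil_ge //.
by rewrite -[leLHS](ceil0 R) le_ceil // mulr_ge0 ?sqrtr_ge0.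
Qed.
End CeilSqrt.

Theorem theorem3p2 (R : realType) (n r : nat) (hn : 2 <= n)
  (hr : 'C(ceil_2sqrt R n, 2) * (n - 1) + ceil_2sqrt R n < r) :
  strong_geodetic_number (cart_prod (path_graph r) (path_graph n))
    = ceil_2sqrt R n.
Proof.
have := ceil_2sqrt_sqr R n; have := @ceil_2sqrt_le R n.
move: (ceil_2sqrt R n) hr => k hr k_min k2.
(* AM-GM gives [4n <= (n + 1)^2]; the construction needs this bound on [a + b = k]. *)
have le_kn : k <= n.+1 by apply: k_min; have [AG _] := nat_AGM2 n 1; lia.
have [|||||S0 sgS0 le_S0] := @strong_geodetic_two_sides r n k./2 (k - k./2).
- by nia.
- by nia.
- by nia.
- by lia.
- by nia.
have [S sgS cardS] := strong_geodetic_number_attained sgS0.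
apply/eqP; rewrite eqn_leq; apply/andP; split.
  by apply: leq_trans (strong_geodetic_number_le sgS0) (leq_trans le_S0 _); lia.
(* The bound on [r] is monotone in the size, so it holds for a smaller [S] too; then [4n <= #|S|^2]
   contradicts the minimality of [k]. *)
rewrite -cardS leqNgt; apply/negP => lt_Sk.
have : k <= #|S|; last by rewrite leqNgt lt_Sk.
apply: k_min; apply: strong_geodetic_card sgS _.
apply: leq_ltn_trans hr; rewrite leq_add ?(ltnW lt_Sk) // leq_mul2r.
by rewrite leq_bin2l ?orbT // ltnW.
Qed.
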